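(* For all integers $k\ge2$ and $m\ge0$, $G(m\vec k)=C((m+1)\vec k)$; i.e. the Geode coefficient of $t_k^m$ equals the number of subdivisions of a roofed polygon into $m+1$ polygons each with $k+1$ sides.
   Context: A type is a vector $\mathbf m=[m_2,m_3,\ldots]$ of natural numbers (indices start at $2$) with finitely many nonzero entries; $\vec k$ is the type with $1$ in position $k$ and $0$ elsewhere, and $\mathbf t^{\mathbf m}=t_2^{m_2}t_3^{m_3}\cdots$. The hyper-Catalan number is $C_{\mathbf m}=\frac{(2m_2+3m_3+4m_4+\cdots)!}{(1+m_2+2m_3+3m_4+\cdots)!\,m_2!\,m_3!\cdots}$ (written $C(\mathbf m)$ when the index is an expression) and $\mathbf S=\sum_{\mathbf m}C_{\mathbf m}\mathbf t^{\mathbf m}$. The Geode $\mathbf G$ is the unique formal power series with $\mathbf S-1=(t_2+t_3+t_4+\cdots)\mathbf G$, and $G(\mathbf n)=G_{\mathbf n}$ is its coefficient of $\mathbf t^{\mathbf n}$. *)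

(* Defs.v *)
From HB Require Import structures.
From mathcomp Require Import all_boot all_order all_algebra.
From mathcomp Require Import finmap.
From mathcomp Require Import boolp classical_sets fsbigop.

Set Implicit Arguments.
Unset Strict Implicit.
Unset Printing Implicit Defensive.

Import GRing.Theory.

Local Open Scope ring_scope.

Definition tindex : Type := {k : nat | (2 <= k)%N}.

Definition mtype : Type := {fsfun tindex -> nat with 0%N}.

Definition mtype0 : mtype := [fsfun].

Definition vec (k : tindex) : mtype := [fsfun i in [fset k]%fset => 1%N].

Definition mscale (n : nat) (m : mtype) : mtype :=
  [fsfun i in finsupp m => (n * m i)%N].

Definition hyperCatalan (m : mtype) : rat :=
  ((\sum_(k <- finsupp m) val k * m k)`!)%:R /
  (((1 + \sum_(k <- finsupp m) (val k).-1 * m k)`! *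
    \prod_(k <- finsupp m) (m k)`!)%N)%:R.

(* Formal power series in t_2, t_3, ..., as coefficient functions. *)
Definition series : Type := mtype -> rat.

Definition sone : series := fun m => (m == mtype0)%:R.

Definition svar (k : tindex) : series := fun m => (m == vec k)%:R.

Definition ssub (f g : series) : series := fun m => f m - g m.

(* The index set of the Cauchy product is finite, so the finitely supported
   sum is the usual one. *)
Definition smul (f g : series) : series := fun m =>
  \sum_(p \in [set p : mtype * mtype |
                 forall i, m i = (p.1 i + p.2 i)%N]%classic) f p.1 * g p.2.

(* t_2 + t_3 + ..., summed coefficientwise: at most one term contributes to
   each coefficient. *)
Definition svars : series := fun m => \sum_(k \in [set: tindex]%classic) svar k m.

Definition hyperS : series := hyperCatalan.

Definition is_geode (G : series) : Prop :=
  ssub hyperS sone = smul svars G.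

(* The vertices of a convex polygon with N sides are numbered 0, ..., N - 1
   in cyclic order, the roof being the side from 0 to N - 1. As the vertices
   are labelled, subdivisions that differ by a rotation or a reflection are
   counted as different. A segment joining the vertices i < j is represented
   by the pair (i, j). *)

(* For vertices i < j of the convex polygon with vertex set A: the segment
   from i to j is a side of that polygon. *)
Definition is_side (N : nat) (A : {set 'I_N}) (i j : 'I_N) : bool :=
  ~~ [exists x in A, (i < x < j)%N] ||
  ~~ [exists x in A, (x < i)%N || (j < x)%N].

Definition is_diagonal (N : nat) (d : 'I_N * 'I_N) : bool :=
  (d.1 < d.2)%N && ~~ is_side [set: 'I_N]%SET d.1 d.2.

Definition crossing (N : nat) (d e : 'I_N * 'I_N) : bool :=
  (d.1 < e.1 < d.2)%N && (d.2 < e.2)%N.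

Definition noncrossing_diagonals (N : nat) (D : {set 'I_N * 'I_N}) : bool :=
  [forall d in D, is_diagonal d] &&
  [forall d in D, forall e in D, ~~ crossing d e].

(* The pieces into which the diagonals in D cut the polygon, given by their
   vertex sets: the segments joining two vertices of a piece that belong to
   the subdivision (as a side of the whole polygon or as a diagonal in D) are
   exactly the sides of the piece. *)
Definition is_piece (N : nat) (D : {set 'I_N * 'I_N}) (A : {set 'I_N}) : bool :=
  (3 <= #|A|)%N &&
  [forall i in A, forall j in A, (i < j)%N ==>
     (is_side A i j == is_side [set: 'I_N]%SET i j || ((i, j) \in D))].

Definition pieces (N : nat) (D : {set 'I_N * 'I_N}) : {set {set 'I_N}} :=
  [set A | is_piece D A]%SET.

Definition subdivisions (N n s : nat) : {set {set 'I_N * 'I_N}} :=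
  [set D | [&& noncrossing_diagonals D, #|pieces D| == n &
            [forall A in pieces D, #|A| == s]]]%SET.

(* Main.v *)
Require Import Defs.
From mathcomp Require Import finmap boolp classical_sets fsbigop.
From mathcomp Require Import all_boot all_order all_algebra.
From mathcomp Require Import zify ring.

(** The only factorisation of [t_k^(m+1)] whose first factor is a variable is
    [t_k * t_k^m], so comparing coefficients in [S - 1 = (t_2 + t_3 + ...) G]
    gives [G(m k) = C((m+1) k)].

    To count the subdivisions, put [q = k - 1] and adjoin the roof to the
    diagonals: each piece is the cell lying directly below exactly one of the
    resulting arcs.  Let [A(r, n)] count the noncrossing families of [n] arcs on
    a path with [r + n q] edges in which every arc has [q + 1] edges directly
    below it and [r] edges remain visible from above.  Either no arc starts at
    the first vertex, which can then be deleted, or the longest arc starting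
    there can be deleted; hence [A(r+1, n+1) = A(r, n+1) + A(r+1+q, n)], whose
    solution is [A(r, n) n! (n q + r)! = r (n (q + 1) + r - 1)!].  The roof
    being deleted, the subdivisions are counted by [A(q + 1, m)]. *)

Set Implicit Arguments.
Unset Strict Implicit.
Unset Printing Implicit Defensive.

Import GRing.Theory Num.Theory.

Local Open Scope ring_scope.

(** * Geode coefficients at multiples of a single variable *)

Lemma vecE (k i : tindex) : vec k i = (i == k).
Proof. by rewrite /vec fsfunE in_fset1; case: eqP. Qed.

Lemma mscaleE n (v : mtype) i : mscale n v i = (n * v i)%N.
Proof.
rewrite /mscale fsfunE; case: finsuppP => [_|//]; by rewrite muln0.
Qed.

Lemma vec_inj : injective vec.
Proof.
move=> j k /fsfunP /(_ j); rewrite !vecE eqxx.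
by case: eqP.
Qed.

Lemma svars_vec k : svars (vec k) = 1.
Proof.
rewrite /svars -(@fsbig_widen _ _ _ _ [set k]%classic) //.
  by rewrite fsbig_set1 /svar eqxx.
move=> j [_ /= jk]; rewrite /svar /=; case: eqP => // /vec_inj kj.
by case: jk.
Qed.

Lemma svars_eq0 p : (forall k, p <> vec k) -> svars p = 0.
Proof.
by move=> pN; apply: fsbig1 => k _; rewrite /svar; case: eqP => // /pN.
Qed.

Lemma geode_scale_vec (G : series) (HG : is_geode G) (k : tindex) m :
  G (mscale m (vec k)) = hyperCatalan (mscale m.+1 (vec k)).
Proof.
have /(congr1 (fun f => f (mscale m.+1 (vec k)))) := HG.
rewrite /ssub /hyperS /sone.
case: eqP => [/fsfunP/(_ k)|_].
  by rewrite mscaleE vecE eqxx fsfunE.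
rewrite subr0 => ->.
(* The Cauchy product is narrowed to one factorisation; every other pair must then be shown to
   contribute zero. *)
rewrite /smul -(@fsbig_widen _ _ _ _ [set (vec k, mscale m (vec k))]%classic).
- by rewrite fsbig_set1 /= svars_vec mul1r.
- by move=> p /= -> i; rewrite /= !mscaleE; lia.
move=> [p1 p2] [/= eqp neqp].
have [[j p1j]|pN] := pselect (exists j, p1 = vec j); last first.
  by rewrite svars_eq0 ?mul0r // => j pj; apply: pN; exists j.
suff jk : j = k.
  case: neqp; rewrite p1j jk; congr (_, _); apply/fsfunP => i.
  by have := eqp i; rewrite p1j jk !mscaleE !vecE; lia.
(* At index [j] the first factor has exponent 1, so the product has a positive exponent there, which
   happens only at [k]. *)
apply/eqP; have := eqp j; rewrite p1j !mscaleE !vecE eqxx.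
by case: (j == k) => //; lia.
Qed.

(** Since [n] is positive, the support is exactly the singleton of [k], so both sums and the product
    have a single term. *)
Lemma hyperCatalan_scale_vec (k : tindex) n : (0 < n)%N ->
  hyperCatalan (mscale n (vec k)) =
  ((val k * n)`!)%:R / ((((val k).-1 * n).+1`! * n`!)%N)%:R.
Proof.
move=> n0; have -> : hyperCatalan (mscale n (vec k)) =
  ((\sum_(i <- [fset k]%fset) val i * mscale n (vec k) i)`!)%:R /
  (((1 + \sum_(i <- [fset k]%fset) (val i).-1 * mscale n (vec k) i)`! *
    \prod_(i <- [fset k]%fset) (mscale n (vec k) i)`!)%N)%:R.
  suff E : finsupp (mscale n (vec k)) = [fset k]%fset.
    by rewrite /hyperCatalan E.
  apply/fsetP => i; rewrite mem_finsupp in_fset1 mscaleE vecE.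
  by case: (i == k) => /=; lia.
by rewrite !big_seq_fset1 mscaleE vecE eqxx muln1 add1n.
Qed.

Local Open Scope nat_scope.

(** * Noncrossing arc families on a path, their cells and visible vertices *)

Definition covered N (E : {set 'I_N * 'I_N}) (x : 'I_N) : bool :=
  [exists f in E, f.1 < x < f.2].

Definition below N (E : {set 'I_N * 'I_N}) (e : 'I_N * 'I_N) :
    {set 'I_N * 'I_N} :=
  [set f in E | [&& f != e, e.1 <= f.1 & f.2 <= e.2]].

(** For an arc [e] of a noncrossing family, this is the vertex set of the piece directly under [e],
    with both ends of [e] included. *)
Definition cell N (E : {set 'I_N * 'I_N}) (e : 'I_N * 'I_N) : {set 'I_N} :=
  [set x : 'I_N | (e.1 <= x <= e.2) && ~~ covered (below E e) x].

Definition top N (E : {set 'I_N * 'I_N}) (a : nat) : {set 'I_N} :=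
  [set x : 'I_N | (a <= x) && ~~ covered E x].

Definition noncrossing N (E : {set 'I_N * 'I_N}) : bool :=
  [forall d in E, forall e in E, ~~ crossing d e].

(** The gap of two rules out arcs over a single edge of the path; the arc over the whole path is
    allowed, so that the roof can be adjoined. *)
Definition arcs_from N (E : {set 'I_N * 'I_N}) (a : nat) : bool :=
  [forall f in E, (a <= f.1) && (f.1 + 2 <= f.2)].

(* The families counted by [A(r, n)], on the path [a, ..., N - 1]; vertices are
   counted instead of edges, whence [q + 2] and [r.+1]. *)
Definition dissections N q a r n : {set {set 'I_N * 'I_N}} :=
  [set E | [&& arcs_from E a, noncrossing E, #|E| == n,
            [forall e in E, #|cell E e| == q + 2] & #|top E a| == r.+1]].

Lemma coveredP N (E : {set 'I_N * 'I_N}) (x : 'I_N) :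
  reflect (exists u v : 'I_N, [/\ (u, v) \in E, u < x & x < v]) (covered E x).
Proof.
apply: (iffP (exists_inP)) => [[[u v] fE /andP[ux xv]]|[u [v [uvE ux xv]]]].
  by exists u, v.
by exists (u, v); rewrite //= ux.
Qed.

Lemma noncrossingP N (E : {set 'I_N * 'I_N}) :
  reflect (forall i j u v : 'I_N, (i, j) \in E -> (u, v) \in E ->
             i < u -> u < j -> j < v -> False) (noncrossing E).
Proof.
apply: (iffP idP) => [nc i j u v ijE uvE iu uj jv|nc].
  have /forall_inP/(_ _ ijE)/forall_inP/(_ _ uvE) := nc.
  by rewrite /crossing /= iu uj jv.
apply/forall_inP => -[i j] ijE; apply/forall_inP => -[u v] uvE.
apply/negP; rewrite /crossing /= => /andP[/andP[? ?] ?].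
by apply: nc ijE uvE _ _ _.
Qed.

Lemma arcs_fromP N (E : {set 'I_N * 'I_N}) a :
  reflect (forall i j : 'I_N, (i, j) \in E -> a <= i /\ i + 2 <= j)
    (arcs_from E a).
Proof.
apply: (iffP forall_inP) => [h i j /h /andP[] //|h [i j] /h [? ?]].
exact/andP.
Qed.

Lemma in_below N (E : {set 'I_N * 'I_N}) (e : 'I_N * 'I_N) (u v : 'I_N) :
  ((u, v) \in below E e) =
  [&& (u, v) \in E, (u, v) != e, e.1 <= u & v <= e.2].
Proof. by rewrite inE. Qed.

Lemma in_cell N (E : {set 'I_N * 'I_N}) e (x : 'I_N) :
  (x \in cell E e) = [&& e.1 <= x, x <= e.2 & ~~ covered (below E e) x].
Proof. by rewrite inE andbA. Qed.

Lemma in_top N (E : {set 'I_N * 'I_N}) a (x : 'I_N) :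
  (x \in top E a) = (a <= x) && ~~ covered E x.
Proof. by rewrite inE. Qed.

Lemma dissectionsP N q a r n (E : {set 'I_N * 'I_N}) :
  reflect [/\ arcs_from E a, noncrossing E, #|E| = n,
            (forall e, e \in E -> #|cell E e| = q + 2) & #|top E a| = r.+1]
   (E \in dissections N q a r n).
Proof.
rewrite inE; apply: (iffP and5P) =>
  [[? ? /eqP ? /forall_inP h /eqP ?]|[? ? /eqP ? h /eqP ?]].
  by split=> // e /h /eqP.
by split=> //; apply/forall_inP => e /h /eqP.
Qed.


(** * Boundary cases of the recursion *)

Lemma card_dissections0 N q a r : N = a + r.+1 -> #|dissections N q a r 0| = 1.
Proof.
move=> NE; apply/eqP/cards1P; exists set0; apply/setP => E; rewrite !inE.
apply/idP/eqP => [/and5P[_ _ /eqP/cards0_eq //]|->].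
apply/and5P; split; rewrite ?cards0 //.
- by apply/arcs_fromP => i j; rewrite inE.
- by apply/noncrossingP => i j u v; rewrite inE.
- by apply/forall_inP => e; rewrite inE.
have -> : top (@set0 ('I_N * 'I_N)%type) a =
    (fun i : 'I_r.+1 => cast_ord (esym NE) (rshift a i)) @: setT.
  apply/setP => x; rewrite in_top; apply/andP/imsetP => [[ax _]|[i _ ->]].
    have xr : x - a < r.+1 by have := ltn_ord x; lia.
    by exists (Ordinal xr) => //; apply/val_inj => /=; lia.
  split; first by rewrite /=; lia.
  by apply/negP => /coveredP[u [v []]]; rewrite inE.
rewrite card_imset ?cardsT ?card_ord // => i j /(congr1 val) /= ij.
by apply/val_inj => /=; lia.
Qed.

(** The vertices [a] and [N.-1] are never covered, and they are distinct, so at least two vertices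
    are visible. *)
Lemma card_dissections_empty_boundary N q a n : a.+1 < N ->
  #|dissections N q a 0 n| = 0.
Proof.
move=> aN; apply/eqP; rewrite cards_eq0; apply/eqP/setP => E; rewrite in_set0.
apply/negP => /dissectionsP[/arcs_fromP aE _ _ _ /eqP/cards1P[z Ez]].
have aN' : a < N by lia.
have bN : N.-1 < N by lia.
have : Ordinal aN' \in [set z].
  rewrite -Ez in_top leqnn /=; apply/negP => /coveredP[u [v [/aE [? _] /=]]]; lia.
have : Ordinal bN \in [set z].
  rewrite -Ez in_top; apply/andP; split; first by rewrite /=; lia.
  apply/negP => /coveredP[u [v [_ _ /=]]]; have := ltn_ord v; lia.
rewrite !inE => /eqP <- /eqP/(congr1 val) /=; lia.
Qed.

(** * Families with no arc at the first vertex *)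

Definition has_arc N (a : 'I_N) (E : {set 'I_N * 'I_N}) : bool :=
  [exists j, (a, j) \in E].

Lemma has_arcP N (a : 'I_N) (E : {set 'I_N * 'I_N}) :
  reflect (exists j, (a, j) \in E) (has_arc a E).
Proof. exact: existsP. Qed.

Lemma top_setU1 N (a : 'I_N) (E : {set 'I_N * 'I_N}) :
  arcs_from E a -> top E a = a |: top E a.+1.
Proof.
move=> /arcs_fromP aE; apply/setP => x; rewrite in_setU1 !in_top.
have [->|xa] := eqVneq x a.
  rewrite leqnn /=; apply/negP => /coveredP[u [v [/aE [? _]]]]; lia.
by congr (_ && _); move: xa; rewrite -val_eqE /=; lia.
Qed.

(** The set of arcs stays the same and cells do not depend on the left end of the path; moving that
    end to [a.+1] only removes [a] from the visible vertices. *)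
Lemma dissections_no_arc N q (a : 'I_N) r n :
  [set E in dissections N q a r.+1 n | ~~ has_arc a E] =
  dissections N q a.+1 r n.
Proof.
apply/setP => E; rewrite inE; apply/andP/idP => [[]|].
  move=> /dissectionsP[aE nc cE cl tE] /has_arcP nl.
  apply/dissectionsP; split=> //.
    apply/arcs_fromP => i j ijE; have [ai ij] := arcs_fromP _ _ aE _ _ ijE.
    split=> //; rewrite ltn_neqAle ai andbT; apply/eqP => /val_inj aii.
    by apply: nl; exists j; rewrite aii.
  by move: tE; rewrite top_setU1 // cardsU1 in_top ltnn /= => -[].
move=> /dissectionsP[aE nc cE cl tE].
have aE' : arcs_from E a.
  by apply/arcs_fromP => i j /(arcs_fromP _ _ aE) [? ?]; split=> //; lia.
split.
  apply/dissectionsP; split=> //.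
  by rewrite top_setU1 // cardsU1 in_top ltnn /= tE.
by apply/has_arcP => -[j /(arcs_fromP _ _ aE)]; lia.
Qed.

(** This locates the far end of an arc to be inserted, from the size its cell must have. The least
    bound with [s] elements of [T] strictly below it is the successor of the required element. *)
Lemma exists_rank N (T : {set 'I_N}) s : 0 < s <= #|T| ->
  exists2 c : 'I_N, c \in T & #|[set x in T | x <= c]| = s.
Proof.
move=> /andP[s0 sT].
have ex : exists t, s <= #|[set x in T | x < t]|.
  exists N; rewrite (_ : [set x in T | x < N] = T) //.
  by apply/setP => x; rewrite inE ltn_ord andbT.
have [[|t] st tmin] := ex_minnP ex.
  move: st; rewrite (_ : [set x in T | x < 0] = set0) ?cards0; first lia.
  by apply/setP => x; rewrite !inE andbF.
have lt_s : #|[set x in T | x < t]| < s.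
  by rewrite ltnNge; apply/negP => /tmin; rewrite ltnn.
have sub : #|[set x in T | x < t.+1]| <=
    #|[set x in T | x < t]| + #|[set x in T | val x == t]|.
  rewrite -cardsUI; apply: leq_trans (leq_addr _ _).
  apply/subset_leq_card/subsetP => x.
  by rewrite !inE => /andP[-> /=]; rewrite ltnS leq_eqVlt orbC.
have [] := set_0Vmem [set x in T | val x == t].
  by move=> E0; move: sub; rewrite E0 cards0; lia.
move=> [c]; rewrite inE => /andP[cT /eqP ct]; exists c => //.
have le1 : #|[set x in T | val x == t]| <= 1.
  apply/card_le1_eqP => x y; rewrite !inE => /andP[_ /eqP xt] /andP[_ /eqP yt].
  by apply/val_inj; rewrite xt.
have -> : [set x in T | x <= c] = [set x in T | x < t.+1].
  by apply/setP => x; rewrite !inE ct ltnS.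
lia.
Qed.

(** Rank increases strictly along [T]. Hence the far end of a deleted arc can be recovered from the
    size of its cell. *)
Lemma rank_inj N (T : {set 'I_N}) (c d : 'I_N) : c \in T -> d \in T ->
  #|[set x in T | x <= c]| = #|[set x in T | x <= d]| -> c = d.
Proof.
have lt (c' d' : 'I_N) : c' \in T -> d' \in T -> c' < d' ->
  #|[set x in T | x <= c']| < #|[set x in T | x <= d']|.
  move=> cT dT cd; apply: proper_card; apply/properP; split.
    by apply/subsetP => x; rewrite !inE => /andP[-> /=]; lia.
  by exists d'; rewrite !inE dT //=; lia.
move=> cT dT eq; apply/val_inj; case: (ltngtP c d) => //.
  by move/(lt _ _ cT dT); rewrite eq ltnn.
by move/(lt _ _ dT cT); rewrite eq ltnn.
Qed.

(** * Adding an arc from the first vertex to a visible vertex *)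

Lemma coveredU1 N (a c : 'I_N) (E : {set 'I_N * 'I_N}) (x : 'I_N) :
  covered ((a, c) |: E) x = (a < x < c) || covered E x.
Proof.
apply/coveredP/orP => [[u [v []]]|[/andP[ax xc]|/coveredP[u [v [uvE ux xv]]]]].
- rewrite in_setU1 => /orP[/eqP[-> ->] -> ->|uvE ux xv]; first by left.
  by right; apply/coveredP; exists u, v.
- by exists a, c; rewrite setU11.
- by exists u, v; rewrite setU1r.
Qed.

Section AddArc.
Context N (a c : 'I_N) (E : {set 'I_N * 'I_N}).
Hypotheses (aE : arcs_from E a) (ac : a + 2 <= c).
Hypotheses (cT : c \in top E a) (acE : (a, c) \notin E).

Let arcE i j : (i, j) \in E -> a <= i /\ i + 2 <= j.
Proof. exact: arcs_fromP. Qed.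

Let c_free i j : (i, j) \in E -> i < c -> c < j -> False.
Proof.
move=> ijE ic cj; have := cT; rewrite in_top => /andP[_ /negP]; apply.
by apply/coveredP; exists i, j.
Qed.

(** The new arc is thus the longest one at [a]: a longer one would hide [c], and one of equal length
    would be the new arc itself. *)
Let a_short j : (a, j) \in E -> j < c.
Proof.
move=> ajE; rewrite ltnNge leq_eqVlt; apply/negP => /orP[/eqP/val_inj cj|cj].
  by move: acE; rewrite cj ajE.
by apply: c_free ajE _ cj; lia.
Qed.

Lemma arcs_from_addarc : arcs_from ((a, c) |: E) a.
Proof.
by apply/arcs_fromP => i j; rewrite in_setU1 => /orP[/eqP[-> ->] //|/arcE].
Qed.

(** No arc starts before [a], so an arc crossing the new one would have to pass over the visible
    vertex [c]. *)
Lemma noncrossing_addarc : noncrossing ((a, c) |: E) = noncrossing E.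
Proof.
apply/noncrossingP/noncrossingP => nc i j u v.
  by move=> ijE uvE; apply: nc; rewrite setU1r.
rewrite !in_setU1 => /orP[/eqP[-> ->]|ijE] /orP[/eqP[-> ->]|uvE] iu uj jv.
- lia.
- exact: c_free uvE uj jv.
- by have [] := arcE ijE; lia.
- exact: nc ijE uvE iu uj jv.
Qed.

(** The new arc lies below no old one: such an old arc would start at [a] and reach [c] or beyond,
    against [a_short]. *)
Lemma cell_addarc e : e \in E -> cell ((a, c) |: E) e = cell E e.
Proof.
case: e => i j ijE.
suff E_e : below ((a, c) |: E) (i, j) = below E (i, j) by rewrite /cell E_e.
apply/setP => -[u v]; rewrite !in_below in_setU1.
have [[-> ->]|//] := eqVneq (u, v) (a, c).
rewrite (negbTE acE) /=; apply/negP => /and3P[_ /= ia cj].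
have ai : a = i by apply/val_inj => /=; have [] := arcE ijE; lia.
by move: ijE; rewrite -ai => /a_short; lia.
Qed.

(** No arc passes over [c], so every arc hiding a vertex up to [c] lies below the new arc. *)
Lemma cell_newarc :
  cell ((a, c) |: E) (a, c) = [set x in top E a | x <= c].
Proof.
apply/setP => x; rewrite in_cell [RHS]inE in_top /=.
have [ax|//] /= := boolP (a <= x).
rewrite andbC; have [xc|] := boolP (x <= c); rewrite ?andbF // !andbT.
congr (~~ _); apply/coveredP/coveredP => -[u [v [uvE ux xv]]]; exists u, v.
  split=> //; move: uvE; rewrite in_below in_setU1 => /and4P[/orP[->|//] /negP].
  by [].
split=> //; rewrite in_below setU1r //=; apply/and3P; split.
- by apply: contraNneq acE => <-.
- by have [] := arcE uvE.
- by rewrite leqNgt; apply/negP => cv; apply: c_free uvE _ cv; lia.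
Qed.

(** Inclusion-exclusion: the new top and the cell of the new arc together make up the old top, and
    share exactly [a] and [c]. *)
Lemma card_top_addarc :
  #|top ((a, c) |: E) a| + #|[set x in top E a | x <= c]| = #|top E a| + 2.
Proof.
have aT : a \in top E a.
  by rewrite in_top leqnn /=; apply/negP => /coveredP[u [v [/arcE]]]; lia.
rewrite -cardsUI; congr (_ + _).
  congr #|pred_of_set _|; apply/setP => x.
  rewrite in_setU in_top coveredU1 [in X in _ || X]inE in_top negb_or.
  by case: (covered E x) => /=; rewrite ?andbF //= ?andbT; lia.
have -> : top ((a, c) |: E) a :&: [set x in top E a | x <= c] = [set a; c].
  apply/setP => x; rewrite in_setI in_top coveredU1 [in X in _ && X]inE in_set2.
  have [->|xa] := eqVneq x a.
    by rewrite aT ltnn leqnn /=; move: aT; rewrite in_top => /andP[_ ->]; lia.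
  have [->|xc] := eqVneq x c.
    by rewrite cT ltnn andbF leqnn /=; move: cT; rewrite in_top => /andP[-> ->].
  move: xa xc; rewrite -!val_eqE /= => xa xc.
  by apply/negP => /andP[/andP[? /norP[? _]] /andP[_ ?]]; lia.
by rewrite cards2 -val_eqE /=; lia.
Qed.

End AddArc.

(** * Deleting the longest arc at the first vertex; the recursion and its solution *)

Definition last_end N (a : 'I_N) (E : {set 'I_N * 'I_N}) : 'I_N :=
  odflt a [pick c | ((a, c) \in E) && [forall j, ((a, j) \in E) ==> (j <= c)]].

Lemma last_endP N (a : 'I_N) (E : {set 'I_N * 'I_N}) : has_arc a E ->
  (a, last_end a E) \in E /\
  forall j : 'I_N, (a, j) \in E -> j <= last_end a E.
Proof.
move=> /has_arcP[j0 ajE]; rewrite /last_end; case: pickP => /= [c|no].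
  by move=> /andP[-> /forallP c_max]; split=> // j /(implyP (c_max j)).
case: (@arg_maxnP _ j0 (fun j => (a, j) \in E) val ajE) => c acE c_max.
have /negP[] := no c; rewrite acE /=.
by apply/forallP => j; apply/implyP; apply: c_max.
Qed.

(** Another arc over the far end would either start at [a], against maximality, or start later and
    cross the longest arc. *)
Lemma last_end_top N (a : 'I_N) (E : {set 'I_N * 'I_N}) :
  arcs_from E a -> noncrossing E -> has_arc a E ->
  last_end a E \in top (E :\ (a, last_end a E)) a.
Proof.
move=> /arcs_fromP aE /noncrossingP nc /last_endP[]; set c := last_end a E.
move=> acE c_max; rewrite in_top; have [_ ac] := aE _ _ acE.
apply/andP; split; first lia.
apply/negP => /coveredP[u [v [/setD1P[_ uvE] uc cv]]].
have [au _] := aE _ _ uvE.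
have [ua|ua] := eqVneq a u; first by move: uvE; rewrite -ua => /c_max; lia.
by apply: nc acE uvE _ uc cv; move: ua; rewrite -val_eqE /=; lia.
Qed.

(** Deleting the longest arc at [a] is a bijection. It turns [r + 2] visible vertices into
    [(r + 2) + (q + 2) - 2], and its inverse draws an arc from [a] to the visible vertex of rank
    [q + 2]. *)
Lemma card_dissections_has_arc N q (a : 'I_N) r n : 0 < q ->
  #|[set E in dissections N q a r.+1 n.+1 | has_arc a E]| =
  #|dissections N q a (r.+1 + q) n|.
Proof.
move=> q0; pose phi (E : {set 'I_N * 'I_N}) := E :\ (a, last_end a E).
have props E : E \in [set E in dissections N q a r.+1 n.+1 | has_arc a E] ->
  let c := last_end a E in
  [/\ (a, c) |: phi E = E, c \in top (phi E) a,
      phi E \in dissections N q a (r.+1 + q) n &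
      #|[set x in top (phi E) a | x <= c]| = q + 2].
  rewrite inE => /andP[/dissectionsP[aE nc cE cl tE] lE] c.
  have [acE c_max] := last_endP lE.
  have EE : (a, c) |: phi E = E by exact: setD1K.
  have cT : c \in top (phi E) a by exact: last_end_top.
  have aE' : arcs_from (phi E) a.
    by apply/arcs_fromP => i j /setD1P[_ /(arcs_fromP _ _ aE)].
  have ac : a + 2 <= c by have [] := arcs_fromP _ _ aE _ _ acE.
  have acN : (a, c) \notin phi E by rewrite setD11.
  have cc : #|[set x in top (phi E) a | x <= c]| = q + 2.
    by rewrite -cell_newarc // EE cl.
  split=> //; apply/dissectionsP; split=> //.
  - by have := noncrossing_addarc aE' ac cT; rewrite EE nc => <-.
  - by have := cardsU1 (a, c) (phi E); rewrite EE cE acN add1n => -[].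
  - move=> e eE; rewrite -(cell_addarc aE' ac cT) // EE cl //.
    by case/setD1P: eE.
  - by have := card_top_addarc aE' ac cT acN; rewrite EE tE cc; lia.
rewrite -(@card_in_imset _ _ phi); last first.
  move=> E1 E2 /props[EE1 c1T _ cc1] /props[EE2 c2T _ cc2] E12.
  rewrite -EE1 -EE2 -E12; congr ((a, _) |: _).
  by apply: (rank_inj c1T); rewrite ?E12 // -E12 cc1 E12 cc2.
apply: eq_card => E'; apply/imsetP/idP => [[E /props[_ _ ? _] ->] //|].
move=> /dissectionsP[aE nc cE cl tE].
have [|c cT cc] := @exists_rank _ (top E' a) (q + 2); first by rewrite tE; lia.
(* As [q] is positive, at least three visible vertices lie up to [c]. This forces [c] to be at
   distance at least two from [a], and the arc from [a] to [c] to be new. *)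
have small : ~ [set x in top E' a | x <= c] \subset [set a; c].
  move/subset_leq_card; rewrite cc cards2; lia.
have ac : a + 2 <= c.
  rewrite leqNgt; apply/negP => ca; apply: small; apply/subsetP => x.
  rewrite inE in_top in_set2 -!val_eqE /= => /andP[/andP[? _] ?]; lia.
have acE : (a, c) \notin E'.
  apply/negP => acE; apply: small; apply/subsetP => x.
  rewrite inE in_top in_set2 -!val_eqE /= => /andP[/andP[ax /negP xN] xc].
  apply/negPn/negP => /norP[xa xc']; apply: xN; apply/coveredP; exists a, c.
  by split=> //; lia.
pose E := (a, c) |: E'.
have lE : has_arc a E by apply/has_arcP; exists c; rewrite setU11.
have Ec : last_end a E = c.
  have [] := last_endP lE; set d := last_end a E => adE d_max.
  have cd : c <= d by apply: d_max; rewrite setU11.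
  move: adE; rewrite in_setU1 => /orP[/eqP[] //|adE].
  apply/val_inj/eqP; rewrite eqn_leq cd andbT leqNgt /=; apply/negP => lt_cd.
  move: cT; rewrite in_top => /andP[_ /negP]; apply.
  by apply/coveredP; exists a, d; split=> //; lia.
exists E; last by rewrite /phi Ec setU1K.
rewrite inE lE andbT; apply/dissectionsP; split.
- exact: arcs_from_addarc.
- by rewrite noncrossing_addarc.
- by rewrite cardsU1 acE cE.
- move=> e /setU1P[->|eE]; first by rewrite cell_newarc.
  by rewrite cell_addarc // cl.
- by have := card_top_addarc aE ac cT acE; rewrite cc tE; rewrite -/E; lia.
Qed.

Lemma card_dissections_rec N q (a : 'I_N) r n : 0 < q ->
  #|dissections N q a r.+1 n.+1| =
  #|dissections N q a.+1 r n.+1| + #|dissections N q a (r.+1 + q) n|.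
Proof.
move=> q0; rewrite -dissections_no_arc -card_dissections_has_arc //.
rewrite -(cardsID [set E | has_arc a E]) addnC; congr (_ + _).
  by apply: eq_card => E; rewrite !inE andbC.
by apply: eq_card => E; rewrite !inE.
Qed.

(** The closed form is stated without division. The case [r = n = 0] is excluded because there the
    left side is 1 and the right side 0. Induction is on [n], then on [r], with the left end [a]
    free to move. *)
Lemma card_dissections N q a r n : 0 < q -> 0 < r + n ->
  N = a + r + n * q + 1 ->
  #|dissections N q a r n| * (n`! * (n * q + r)`!) = r * ((n * q.+1 + r).-1)`!.
Proof.
move=> q0; elim: n a r => [|n IHn] a r.
  rewrite addn0 => r0 NE; rewrite card_dissections0; last by lia.
  by case: r r0 NE => // r _ _; rewrite !mul0n !add0n fact0 !mul1n factS.
elim: r a => [|r IHr] a _ NE.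
  by rewrite card_dissections_empty_boundary //; nia.
have aN : a < N by lia.
have -> := card_dissections_rec (Ordinal aN) r n q0.
rewrite [nat_of_ord _]/=.
have /IHr e1 : 0 < r + n.+1 by rewrite addnS.
have /e1 {}e1 : N = a.+1 + r + n.+1 * q + 1 by lia.
have /IHn e2 : 0 < r.+1 + q + n by lia.
have /e2 {}e2 : N = a + (r.+1 + q) + n * q + 1 by lia.
have E0 : n.+1 * q + r.+1 = (n.+1 * q + r).+1 by lia.
have E1 : n * q + (r.+1 + q) = (n.+1 * q + r).+1 by lia.
have E2 : n * q.+1 + (r.+1 + q) = n.+1 * q.+1 + r by lia.
have [t E3] : exists t, n.+1 * q.+1 + r = t.+1.
  by exists (n * q.+1 + q + r); lia.
have E4 : n.+1 * q.+1 + r.+1 = t.+2 by lia.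
move: e1 e2; rewrite E0 E1 E2 E3 E4 !factS !succnK.
move: #|dissections N q a.+1 r n.+1| #|dissections N q a (r.+1 + q) n|.
move=> c1 c2 e1 e2.
(* The product is regrouped to expose both induction hypotheses. There remains [(n.+1 * q + r).+1 *
   r + n.+1 * (r.+1 + q) = r.+1 * (n.+1 * q.+1 + r)], times a factorial. *)
have -> : (c1 + c2) * (n.+1 * n`! * ((n.+1 * q + r).+1 * (n.+1 * q + r)`!)) =
  (n.+1 * q + r).+1 * (c1 * (n.+1 * n`! * (n.+1 * q + r)`!)) +
  n.+1 * (c2 * (n`! * ((n.+1 * q + r).+1 * (n.+1 * q + r)`!))) by ring.
rewrite e1 e2.
have -> : t.+1 = n.+1 * q.+1 + r by lia.
by ring.
Qed.

(** * Pieces are exactly the cells of arcs *)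

Lemma ord_max_ex N (P : pred 'I_N) (x : 'I_N) : P x ->
  exists2 c, P c & forall y : 'I_N, P y -> y <= c.
Proof. by move=> Px; case: (@arg_maxnP _ x P val Px) => c; exists c. Qed.

Lemma ord_min_ex N (P : pred 'I_N) (x : 'I_N) : P x ->
  exists2 c, P c & forall y : 'I_N, P y -> c <= y.
Proof. by move=> Px; case: (@arg_minnP _ x P val Px) => c; exists c. Qed.

Lemma is_sideP N (A : {set 'I_N}) (i j : 'I_N) :
  reflect ((forall x, x \in A -> i < x -> x < j -> False) \/
           (forall x, x \in A -> i <= x /\ x <= j)) (is_side A i j).
Proof.
apply: (iffP orP) => -[].
- move=> /exists_inP nx; left => x xA ix xj; apply: nx; exists x => //.
  by rewrite ix.
- move=> /exists_inP nx; right => x xA; apply/andP; apply/negPn/negP => xN.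
  by apply: nx; exists x => //; lia.
- move=> nx; left; apply/exists_inP => -[x xA /andP[ix xj]].
  exact: nx xA ix xj.
- move=> nx; right; apply/exists_inP => -[x /nx]; lia.
Qed.

Lemma is_side_setT N (i j : 'I_N) : i < j ->
  is_side [set: 'I_N] i j =
  (j == i.+1 :> nat) || (i == 0 :> nat) && (j == N.-1 :> nat).
Proof.
move=> ij; have jN := ltn_ord j.
apply/is_sideP/idP => [[h|h]|/orP[/eqP ji|/andP[/eqP i0 /eqP jN']]].
- apply/orP; left; have iN : i.+1 < N by lia.
  have := h (Ordinal iN) (in_setT _); rewrite /=; lia.
- have zN : 0 < N by lia.
  have bN : N.-1 < N by lia.
  have := h (Ordinal zN) (in_setT _); have := h (Ordinal bN) (in_setT _).
  rewrite /=; lia.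
- by left=> x _; lia.
- by right=> x _; have := ltn_ord x; lia.
Qed.

(** Only edges of the path count automatically; the roof must be an element of [E], so that every
    piece lies under an arc. *)
Definition seg N (E : {set 'I_N * 'I_N}) (i j : 'I_N) : bool :=
  (j == i.+1 :> nat) || ((i, j) \in E).

Definition piece_of N (E : {set 'I_N * 'I_N}) (A : {set 'I_N}) : Prop :=
  3 <= #|A| /\
  forall i j, i \in A -> j \in A -> i < j -> is_side A i j = seg E i j.

(* Boolean membership hypotheses are atoms on which lia would split cases. *)
Ltac ord_lia :=
  repeat match goal with
  | H : is_true (in_mem _ _) |- _ => clear H
  | H : is_true (~~ in_mem _ _) |- _ => clear H
  | H : is_true (noncrossing _) |- _ => clear H
  | H : is_true (arcs_from _ _) |- _ => clear H
  | H : is_true (seg _ _ _) |- _ => clear H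
  | H : is_true (@eq_op _ (_, _) _) |- _ => clear H
  | H : is_true (~~ (@eq_op _ (_, _) _)) |- _ => clear H
  | H : forall x, @?P x |- _ => clear H
  end; lia.

Section Cells.
Context N (E : {set 'I_N * 'I_N}).
Hypotheses (aE : arcs_from E 0) (ncE : noncrossing E).

Let arcE i j : (i, j) \in E -> i + 2 <= j.
Proof. by move=> /(arcs_fromP _ _ aE) []. Qed.

Let nc i j u v : (i, j) \in E -> (u, v) \in E ->
  i < u -> u < j -> j < v -> False.
Proof. exact: noncrossingP. Qed.

Let uncovered i j x u v : x \in cell E (i, j) -> (u, v) \in E ->
  (u, v) <> (i, j) ->
  i <= u -> v <= j -> u < x -> x < v -> False.
Proof.
rewrite in_cell => /and3P[_ _ /negP nx] uvE /eqP neq iu vj ux xv.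
by apply: nx; apply/coveredP; exists u, v; rewrite in_below uvE neq /= iu vj.
Qed.

Lemma cell_bounds i j x : x \in cell E (i, j) -> i <= x <= j.
Proof. by rewrite in_cell => /and3P[-> ->]. Qed.

Lemma cell_left i j : (i, j) \in E -> i \in cell E (i, j).
Proof.
move=> /arcE ij; rewrite in_cell leqnn /=; apply/andP; split; first ord_lia.
by apply/negP => /coveredP[u [v []]]; rewrite in_below /=; ord_lia.
Qed.

Lemma cell_right i j : (i, j) \in E -> j \in cell E (i, j).
Proof.
move=> /arcE ij; rewrite in_cell leqnn /=; apply/andP; split; first ord_lia.
by apply/negP => /coveredP[u [v []]]; rewrite in_below /=; ord_lia.
Qed.

(** The longest segment from [x] inside [(i, j)], other than [(i, j)] itself, ends at the next
    vertex of the cell. An arc hiding that end would hide [x], be a longer segment from [x], or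
    cross the chosen one. *)
Lemma cell_next i j x : (i, j) \in E -> x \in cell E (i, j) -> x < j ->
  exists2 y, y \in cell E (i, j) & [/\ x < y, (x, y) <> (i, j) & seg E x y].
Proof.
move=> ijE xC xj; have ij := arcE ijE; have jN := ltn_ord j.
have x1N : x.+1 < N by ord_lia.
have /andP[ix _] := cell_bounds xC.
pose P (y : 'I_N) := [&& seg E x y, y <= j & (x, y) != (i, j)].
have P0 : P (Ordinal x1N).
  rewrite /P /seg /= eqxx xj /=; apply/eqP => -[xi /(congr1 val) /= xj'].
  by move: ij; rewrite -xi; ord_lia.
have [y /and3P[sxy yj neq] ymax] := ord_max_ex P0.
have xy : x < y.
  by move: sxy => /orP[/eqP -> //|/arcE]; ord_lia.
exists y; last by split=> //; apply/eqP.
rewrite in_cell /= yj (leq_trans ix (ltnW xy)) /=.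
apply/negP => /coveredP[u [v []]].
rewrite in_below /= => /and4P[uvE uvN iu vj] uy yv.
have [xu|ux|/val_inj xu] := ltngtP x u.
- move: sxy => /orP[/eqP y1|xyE]; first ord_lia.
  exact: nc xyE uvE xu uy yv.
- by apply: (uncovered xC uvE) => //; [exact/eqP|ord_lia].
- have := ymax v; rewrite /P /seg xu uvE orbT vj uvN => /(_ isT); ord_lia.
Qed.

Lemma card_cell_ge3 i j : (i, j) \in E -> 3 <= #|cell E (i, j)|.
Proof.
move=> ijE; have ij := arcE ijE; have iC := cell_left ijE.
have [|y yC [iy neq _]] := cell_next ijE iC; first ord_lia.
have /andP[_ yj] := cell_bounds yC.
have nyj : y <> j by move=> yj'; apply: neq; rewrite yj'.
have yj' : y < j by rewrite ltn_neqAle yj andbT; apply/eqP => /val_inj.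
have <- : #|[set i; y; j]| = 3.
  by rewrite -setUA cardsU1 cards2 !inE -!val_eqE /=; ord_lia.
apply/subset_leq_card/subsetP => x; rewrite in_setU in_set2 in_set1 -orbA.
by case/or3P=> /eqP -> //; apply: cell_right.
Qed.

Lemma cell_piece i j : (i, j) \in E -> piece_of E (cell E (i, j)).
Proof.
move=> ijE; split=> [|x y xC yC xy]; first exact: card_cell_ge3.
have /andP[ix xj] := cell_bounds xC; have /andP[iy yj] := cell_bounds yC.
apply/is_sideP/idP => [[h|h]|/orP[/eqP y1|xyE]].
(* The successor [z] of [x] in the cell must be [y]: it cannot come earlier by [h], and if it came
   later the arc to it would hide [y]. *)
- have [|z zC [xz neq sxz]] := cell_next ijE xC; first ord_lia.
  have [zy|yz|/val_inj <- //] := ltngtP z y; first by have := h z zC xz zy.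
  move: sxz => /orP[/eqP|xzE]; first ord_lia.
  by have /andP[_ zj] := cell_bounds zC; case: (uncovered yC xzE neq).
- have [+ _] := h _ (cell_left ijE); have [_ +] := h _ (cell_right ijE).
  move=> jy xi; rewrite /seg.
  have -> : x = i by apply/val_inj/eqP; rewrite eqn_leq xi.
  have -> : y = j by apply/val_inj/eqP; rewrite eqn_leq yj.
  by rewrite ijE orbT.
- by left => z _; ord_lia.
- have [[-> ->]|neq] := eqVneq (x, y) (i, j).
    by right=> z /cell_bounds/andP.
  left=> z zC xz zy; exact: (uncovered zC xyE (elimN eqP neq)).
Qed.

(** The arc joins the extreme vertices of [A]. A cell vertex outside [A] would be hidden by the arc
    between its two neighbours in [A]. Conversely, an arc below that hides a vertex of [A] would
    have both ends in [A], hence be a side of [A], which is impossible. *)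
Lemma piece_cell A : piece_of E A -> exists2 e, e \in E & A = cell E e.
Proof.
move=> [A3 sideA].
have [z zA] : exists z, z \in A by apply/set0Pn; rewrite -card_gt0; ord_lia.
have [i /= iA imin] := @ord_min_ex _ (fun w => w \in A) z zA.
have [j /= jA jmax] := @ord_max_ex _ (fun w => w \in A) z zA.
have big (B : {set 'I_N}) : A \subset B -> 3 <= #|B|.
  by move/subset_leq_card; apply: leq_trans.
have ij1 : i.+1 < j.
  rewrite ltnNge; apply/negP => ji; have /big : A \subset [set i; j].
    apply/subsetP => x xA; rewrite in_set2 -!val_eqE /=.
    by have := imin _ xA; have := jmax _ xA; ord_lia.
  by rewrite cards2; ord_lia.
have ijE : (i, j) \in E.
  have ij : i < j by ord_lia.
  have := sideA i j iA jA ij; rewrite /seg.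
  have -> : is_side A i j.
    by apply/is_sideP; right=> x xA; rewrite imin // jmax.
  by move/esym/orP => [/eqP|//]; ord_lia.
have noA (p s : 'I_N) : p \in A -> s \in A -> p < s ->
    (forall x, x \in A -> p < x -> x < s -> False) -> seg E p s.
  by move=> pA sA ps h; rewrite -sideA //; apply/is_sideP; left.
exists (i, j) => //; apply/setP => x; apply/idP/idP => [xA|xC]; last first.
  have /andP[ix xj] := cell_bounds xC.
  apply/negPn/negP => xA.
  have neA (w : 'I_N) : w \in A -> x != w :> nat.
    by move=> wA; apply: contraNneq xA => /val_inj ->.
  have [|p /andP[pA px] pmax] :=
    @ord_max_ex _ (fun w => (w \in A) && (w < x)) i.
    by rewrite iA; have := neA _ iA; ord_lia.
  have [|s /andP[sA xs] smin] :=
    @ord_min_ex _ (fun w => (w \in A) && (x < w)) j.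
    by rewrite jA; have := neA _ jA; ord_lia.
  have ps : p < s by ord_lia.
  have gap w : w \in A -> p < w -> w < s -> False.
    move=> wA pw ws; have := neA _ wA; have := pmax w; have := smin w.
    rewrite wA /=; ord_lia.
  have /orP[/eqP|psE] := noA _ _ pA sA ps gap; first ord_lia.
  apply: (uncovered xC psE _ _ _ px xs); [|exact: imin|exact: jmax].
  (* If the gap spanned the extreme vertices, [A] would have only two elements. *)
  move=> [pi sj]; have /big : A \subset [set i; j].
    apply/subsetP => w wA; rewrite in_set2 -!val_eqE /=.
    have := imin _ wA; have := jmax _ wA; have := gap _ wA; rewrite pi sj.
    move=> g1 g2 g3; apply/negPn/negP => /norP[? ?]; apply: g1; ord_lia.
  by rewrite cards2; ord_lia.
rewrite in_cell imin ?jmax //=; apply/negP => /coveredP[u [v []]].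
rewrite in_below /= => /and4P[uvE neq iu vj] ux xv.
(* Otherwise the consecutive elements [p] and [s] of [A] around [u] are joined by an arc crossing
   [(u, v)], since [s <= x < v]. The argument for [v] is symmetric. *)
have uA : u \in A.
  have [|p /andP[pA pu] pmax] :=
    @ord_max_ex _ (fun w => (w \in A) && (w <= u)) i.
    by rewrite iA.
  have [|s /andP[sA us] smin] :=
    @ord_min_ex _ (fun w => (w \in A) && (u < w)) x.
    by rewrite xA.
  have gap w : w \in A -> p < w -> w < s -> False.
    by move=> wA pw ws; have := pmax w; have := smin w; rewrite wA /=; ord_lia.
  have sx : s <= x by apply: smin; rewrite xA.
  have [pu'|up|/val_inj <- //] := ltngtP p u; last ord_lia.
  have ps : p < s by ord_lia.
  have /orP[/eqP|psE] := noA _ _ pA sA ps gap; first ord_lia.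
  by case: (nc psE uvE pu' us); ord_lia.
have vA : v \in A.
  have [|s /andP[sA vs] smin] :=
    @ord_min_ex _ (fun w => (w \in A) && (v <= w)) j.
    by rewrite jA.
  have [|p /andP[pA pv] pmax] :=
    @ord_max_ex _ (fun w => (w \in A) && (w < v)) x.
    by rewrite xA.
  have gap w : w \in A -> p < w -> w < s -> False.
    by move=> wA pw ws; have := pmax w; have := smin w; rewrite wA /=; ord_lia.
  have xp : x <= p by apply: pmax; rewrite xA.
  have [sv|vs'|/val_inj <- //] := ltngtP s v; first ord_lia.
  have ps : p < s by ord_lia.
  have /orP[/eqP|psE] := noA _ _ pA sA ps gap; first ord_lia.
  by case: (nc uvE psE _ pv vs'); ord_lia.
have uv : u < v by ord_lia.
have := sideA u v uA vA uv; rewrite /seg uvE orbT => /is_sideP[h|h].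
  by case: (h x xA ux xv).
have [+ _] := h _ iA; have [_ +] := h _ jA => jv ui.
case/eqP: neq; congr (_, _); apply/val_inj/eqP; rewrite eqn_leq.
  by rewrite ui.
by rewrite vj.
Qed.

(** The ends of an arc are the extreme vertices of its cell. *)
Lemma cell_inj : {in E &, injective (cell E)}.
Proof.
move=> [i j] [u v] ijE uvE eqC.
have := cell_bounds (_ : i \in cell E (u, v)).
rewrite -eqC => /(_ (cell_left ijE)).
have := cell_bounds (_ : j \in cell E (u, v)).
rewrite -eqC => /(_ (cell_right ijE)).
have := cell_bounds (_ : u \in cell E (i, j)).
rewrite eqC => /(_ (cell_left uvE)).
have := cell_bounds (_ : v \in cell E (i, j)).
rewrite eqC => /(_ (cell_right uvE)).
by move=> ? ? ? ?; congr (_, _); apply/val_inj => /=; ord_lia.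
Qed.

End Cells.

(** * Adjoining the roof to the diagonals *)

Section Roof.
Context N (lo hi : 'I_N) (D : {set 'I_N * 'I_N}).
Hypotheses (lo0 : lo = 0 :> nat) (hiN : hi = N.-1 :> nat) (N3 : 2 < N).

(** Among pairs at distance at least two, the roof is the only side of the polygon. *)
Lemma noncrossing_diagonalsE :
  noncrossing_diagonals D =
  [&& arcs_from D 0, noncrossing D & (lo, hi) \notin D].
Proof.
have diagE (i j : 'I_N) : is_diagonal (i, j) =
    (i + 2 <= j) && ((i, j) != (lo, hi)).
  rewrite /is_diagonal /= xpair_eqE -!val_eqE /= lo0 hiN.
  have [ij|ij] := boolP (i < j); last by apply/esym/negP => /andP[? _]; lia.
  by rewrite is_side_setT // negb_or; congr (_ && _); lia.
rewrite /noncrossing_diagonals -/(noncrossing D) andbCA andbC; congr (_ && _).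
apply/forall_inP/andP => [h|[/arcs_fromP h1 h2] [i j] ijD].
  split; last by apply/negP => /h; rewrite diagE eqxx andbF.
  by apply/arcs_fromP => i j /h; rewrite diagE => /andP[].
rewrite diagE; have [_ ->] := h1 _ _ ijD.
by apply: contraNneq h2 => <-.
Qed.

Lemma is_pieceP A : reflect (piece_of ((lo, hi) |: D) A) (is_piece D A).
Proof.
have segE (i j : 'I_N) : i < j ->
    is_side [set: 'I_N] i j || ((i, j) \in D) = seg ((lo, hi) |: D) i j.
  move=> ij; rewrite is_side_setT // /seg in_setU1 xpair_eqE orbA -!val_eqE /=.
  by rewrite lo0 hiN.
apply: (iffP andP) => -[A3 sideA]; split=> //.
  move=> i j iA jA ij; rewrite -segE //.
  by move: sideA => /forall_inP/(_ i iA)/forall_inP/(_ j jA)/implyP/(_ ij)/eqP.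
apply/forall_inP => i iA; apply/forall_inP => j jA; apply/implyP => ij.
by rewrite segE // sideA.
Qed.

Hypotheses (aD : arcs_from D 0) (ncD : noncrossing D).
Hypothesis (roofD : (lo, hi) \notin D).

Let aD' : arcs_from D lo. Proof. by rewrite lo0. Qed.

Let lohi : lo + 2 <= hi. Proof. by rewrite lo0 hiN; lia. Qed.

(** With this, the roof is an instance of the arc additions treated above. *)
Let hi_top : hi \in top D lo.
Proof.
rewrite in_top; apply/andP; split; first lia.
apply/negP => /coveredP[u [v [_ _]]]; have := ltn_ord v; lia.
Qed.

Lemma cell_roof : cell ((lo, hi) |: D) (lo, hi) = top D 0.
Proof.
rewrite cell_newarc // lo0; apply/setP => x; rewrite [LHS]inE.
by have -> : x <= hi; [have := ltn_ord x; lia | rewrite andbT].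
Qed.

Lemma pieces_cells :
  pieces D = [set cell ((lo, hi) |: D) e | e in (lo, hi) |: D].
Proof.
have aE : arcs_from ((lo, hi) |: D) 0 by rewrite -lo0 arcs_from_addarc.
have ncE : noncrossing ((lo, hi) |: D) by rewrite noncrossing_addarc.
apply/setP => A; rewrite inE.
apply/is_pieceP/imsetP => [/(piece_cell ncE)|[[i j] ijE ->]].
  exact.
exact: cell_piece.
Qed.

Lemma card_pieces : #|pieces D| = #|D|.+1.
Proof.
have aE : arcs_from ((lo, hi) |: D) 0 by rewrite -lo0 arcs_from_addarc.
rewrite pieces_cells card_in_imset; last exact: cell_inj.
by rewrite cardsU1 roofD.
Qed.

(** The roof's piece consists of the visible vertices, and adding the roof leaves the other cells
    unchanged. *)
Lemma forall_pieces s :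
  [forall A in pieces D, #|A| == s] =
  (#|top D 0| == s) && [forall e in D, #|cell D e| == s].
Proof.
rewrite pieces_cells; apply/forall_inP/andP => [h|[h1 /forall_inP h2] A].
  split; first by rewrite -cell_roof h // imset_f // setU11.
  apply/forall_inP => e eD.
  by rewrite -(cell_addarc aD' lohi hi_top roofD) // h // imset_f // setU1r.
case/imsetP=> e /setU1P[->|eD] ->; first by rewrite cell_roof.
by rewrite (cell_addarc aD' lohi hi_top roofD) // h2.
Qed.

End Roof.

(** * Counting subdivisions through arc families *)

Lemma subdivisions_dissections N q m : 2 < N -> 0 < q ->
  subdivisions N m.+1 (q + 2) = dissections N q 0 (q + 1) m.
Proof.
move=> N3 q0; have loN : 0 < N by lia.
have hiN : N.-1 < N by lia.
pose lo := Ordinal loN; pose hi := Ordinal hiN.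
apply/setP => D; rewrite [LHS]inE [RHS]inE (@noncrossing_diagonalsE _ lo hi) //.
have [aD /=|//] := boolP (arcs_from D 0).
have [ncD /=|//] := boolP (noncrossing D).
have [roofD|roofD] /= := boolP ((lo, hi) \in D); last first.
  rewrite (@card_pieces _ lo hi) // (@forall_pieces _ lo hi) // eqSS.
  by rewrite [X in _ && X]andbC addn2 addn1.
(* A family containing the roof leaves only the two end vertices visible, fewer than the required
   [q + 2]. *)
apply/esym/negP => /and3P[_ _ /eqP tD].
have /subset_leq_card : top D 0 \subset [set lo; hi].
  apply/subsetP => x; rewrite in_top in_set2 -!val_eqE /= => /negP xN.
  apply/negPn/negP => /norP[x0 xh]; apply: xN; apply/coveredP; exists lo, hi.
  by split=> //=; have := ltn_ord x; lia.
by rewrite tD cards2; lia.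
Qed.

Lemma card_subdivisions k m : 2 <= k ->
  #|subdivisions (m.+1 * k.-1 + 2) m.+1 k.+1| *
    ((k.-1 * m.+1).+1`! * (m.+1)`!) =
  (k * m.+1)`!.
Proof.
case: k => // q; rewrite ltnS succnK => q0.
have -> : q.+2 = q + 2 by rewrite addn2.
rewrite subdivisions_dissections //; last by nia.
have := @card_dissections (m.+1 * q + 2) q 0 (q + 1) m q0.
have E1 : m * q + (q + 1) = (q * m.+1).+1 by lia.
have [t E2] : exists t, q.+1 * m.+1 = t.+1 by exists (q * m.+1 + m); lia.
have E3 : m * q.+1 + (q + 1) = t.+1 by lia.
rewrite E1 E2 E3 succnK !(factS m) (factS t) -E2 => X.
have {X} : #|dissections (m.+1 * q + 2) q 0 (q + 1) m| *
    (m`! * (q * m.+1).+1`!) = (q + 1) * t`!.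
  by apply: X; lia.
move: #|_| => c X.
(* Multiplying the closed form by [m.+1] completes both factorials, because [t.+1 = q.+1 * m.+1]. *)
have -> : c * ((q * m.+1).+1`! * (m.+1 * m`!)) =
  m.+1 * (c * (m`! * (q * m.+1).+1`!)) by ring.
by rewrite X; ring.
Qed.

Local Open Scope ring_scope.

Theorem theorem7 (G : series) (HG : is_geode G)
    (k m : nat) (hk : (2 <= k)%N) :
  let vk := vec (exist (fun k : nat => (2 <= k)%N) k hk) in
  G (mscale m vk) = hyperCatalan (mscale m.+1 vk) /\
  G (mscale m vk) =
    #|subdivisions (m.+1 * k.-1 + 2) m.+1 k.+1|%:R.
Proof.
move=> vk; have GE := geode_scale_vec HG (exist _ k hk) m.
split; first exact: GE.
(* The numerator becomes the number of subdivisions times the denominator, which then cancels. *)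
rewrite [LHS]GE hyperCatalan_scale_vec // -(card_subdivisions m hk).
rewrite natrM mulfK //.
by rewrite pnatr_eq0 muln_eq0 negb_or -!lt0n !fact_gt0.
Qed.
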